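(* Let $n\ge 1$, $r\ge 2$ and $s\ge 0$ be integers, let $\mathcal{P}=\{P_1,\dots,P_l\}$ be a partition of $[n]$ with $|P_i|\le r$ for all $i$, and let $\mathcal{F}$ be a family of non-empty subsets of $[n]$ such that $s<|F|$ for every $F\in\mathcal{F}$. If the pair $(\mathcal{F},\mathcal{P})$ is $\lfloor s/2\rfloor$-good, then $$\chi(\mathrm{KG}^r(\mathcal{F},\mathcal{P},s))\ge \left\lceil\frac{\mathrm{ecd}^r(\mathcal{F},\lfloor s/2\rfloor)}{r-1}\right\rceil.$$
   Context: A set $A\subseteq[n]$ is $\mathcal{P}$-admissible if $|A\cap P_i|\le1$ for all $i$. $\mathrm{KG}^r(\mathcal{F},\mathcal{P},s)$ is the $r$-uniform hypergraph whose vertices are the $\mathcal{P}$-admissible $F\in\mathcal{F}$ and whose edges are all $r$-subsets $\{F_1,\dots,F_r\}$ of the vertex set with $|F_i\cap F_j|\le s$ for all $1\le i<j\le r$. $\chi$ denotes the chromatic number (minimum number of colors in a vertex coloring with no monochromatic edge). For $s'\ge0$ and $A,B\subseteq[n]$, write $A\subseteq_{s'}B$ if there is a set $E$ with $|E|\le s'$ and $A\setminus E\subseteq B$. The pair $(\mathcal{F},\mathcal{P})$ is $s'$-good if for every $\mathcal{P}$-admissible $A\subseteq[n]$ for which some $F\in\mathcal{F}$ satisfies $F\subseteq_{s'}A$, there is a $\mathcal{P}$-admissible $F'\in\mathcal{F}$ with $F'\subseteq_{s'}A$. An equitable partition of $X$ into $r$ parts is a partition $X=X_1\cup\dots\cup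 X_r$ (parts possibly empty) with $||X_i|-|X_j||\le1$ for all $i,j$. $\mathrm{ecd}^r(\mathcal{F},s')$ is the minimum size of a set $X_0\subseteq[n]$ such that there is an equitable partition $[n]\setminus X_0=X_1\cup\dots\cup X_r$ with no $F\in\mathcal{F}$ and $i$ satisfying $F\subseteq_{s'}X_i$. *)

(* Defs.v *)
From mathcomp Require Import all_boot all_order all_algebra.

Set Implicit Arguments.
Unset Strict Implicit.
Unset Printing Implicit Defensive.

(* A hypergraph on the finite vertex type V is given by its set of edges. *)
Section Coloring.

Variable V : finType.
Implicit Types (E : {set {set V}}) (e : {set V}).

Definition monochromatic k (c : {ffun V -> 'I_k}) e :=
  [forall u in e, forall v in e, c u == c v].

Definition colorable E k :=
  [exists c : {ffun V -> 'I_k}, [forall e in E, ~~ monochromatic c e]].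

(* Colors 0, ..., #|V| - 1 suffice as soon as every edge has at least two     *)
(* vertices; see chromatic_numberP. Otherwise no coloring exists and the      *)
(* value is the meaningless default #|V|.                                     *)
Definition chromatic_number E : nat :=
  [arg min_(k < (ord_max : 'I_#|V|.+1) | colorable E k) (k : nat)].

Lemma chromatic_numberP E : (forall e, e \in E -> 1 < #|e|) ->
  colorable E (chromatic_number E) /\
  forall k, colorable E k -> chromatic_number E <= k.
Proof.
move=> E2; rewrite /chromatic_number.
case: arg_minnP => [|i Ei i_min].
  apply/existsP; exists [ffun v => enum_rank v]; apply/forall_inP => e /E2.
  case/card_gt1P => u [v [ue ve uv]]; apply: contraNN uv.
  move/forall_inP => /(_ u ue)/forall_inP/(_ v ve).
  by rewrite !ffunE => /eqP/enum_rank_inj ->.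
split=> // k Ek; case: (ltnP k #|V|.+1) => [ltk|/ltnW lek].
  exact: (i_min (Ordinal ltk)).
by apply: leq_trans lek; rewrite -ltnS ltn_ord.
Qed.

End Coloring.

Section Families.

Variable T : finType.
Implicit Types (A B X : {set T}) (F P : {set {set T}}).

(* A \subseteq_{s'} B: the exceptional set X need not be a subset of A. *)
Definition near_subset s' A B :=
  [exists X : {set T}, (#|X| <= s') && (A :\: X \subset B)].

Definition admissible P A := [forall B in P, #|A :&: B| <= 1].

Definition good F P s' : Prop := forall A, admissible P A ->
  (exists2 B, B \in F & near_subset s' B A) ->
  exists B, [/\ B \in F, admissible P B & near_subset s' B A].

(* Quantifying over both (i, j) and (j, i) bounds the absolute difference of  *)
(* the cardinals by 1. Parts may be empty.                                    *)
Definition equitable_partition r (X : {set T}) (Y : {ffun 'I_r -> {set T}}) :=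
  [&& \bigcup_i Y i == X,
      [forall i, forall j, (i != j) ==> [disjoint Y i & Y j]]
    & [forall i, forall j, #|Y i| <= #|Y j| + 1]].

Definition ecd_admits r F s' X0 :=
  [exists Y : {ffun 'I_r -> {set T}}, equitable_partition (~: X0) Y
    && [forall B in F, forall i, ~~ near_subset s' B (Y i)]].

(* The default setT is a valid choice of X0 whenever s' < #|B| for all B in F *)
(* (see ecdP), so that ecd is then a genuine minimum.                         *)
Definition ecd r F s' : nat :=
  #|[arg min_(X0 < [set: T] | ecd_admits r F s' X0) #|X0| ]|.

Lemma ecdP r F s' : (forall B, B \in F -> s' < #|B|) ->
  (exists2 X0, ecd_admits r F s' X0 & #|X0| = ecd r F s') /\
  forall X0, ecd_admits r F s' X0 -> ecd r F s' <= #|X0|.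
Proof.
move=> Fs; rewrite /ecd; case: arg_minnP => [|X0 X0P X0min]; last first.
  by split=> //; exists X0.
apply/existsP; exists [ffun=> set0]; apply/andP; split.
  apply/and3P; split.
  - by rewrite setCT; apply/eqP/big1 => i _; rewrite ffunE.
  - apply/forallP=> i; apply/forallP=> j; apply/implyP => _.
    by rewrite !ffunE -setI_eq0 setI0.
  - by apply/forallP=> i; apply/forallP=> j; rewrite !ffunE cards0.
apply/forall_inP=> B /Fs; rewrite ltnNge => sB; apply/forallP => i.
apply: contraNN sB; rewrite ffunE => /existsP[X /andP[sX]].
by rewrite subset0 setD_eq0 => /subset_leq_card/leq_trans; apply.
Qed.

(* The vertex set is a subtype, so that colorings and edges range over the    *)
(* admissible members of F only; the chromatic number is 0 if there are none. *)
Definition KG_vertex F P := {A : {set T} | (A \in F) && admissible P A}.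

Definition KG r F P s : {set {set KG_vertex F P}} :=
  [set e : {set KG_vertex F P} | (#|e| == r) &&
    [forall A in e, forall B in e, (A != B) ==> (#|val A :&: val B| <= s)]].

End Families.

(* Main.v *)
Require Import Defs.
From mathcomp Require Import all_boot all_order all_algebra.
From mathcomp Require Import ring zify.

(** Both sides are controlled by a statement about up-closed families [G c], one
    per colour, none of which contains [r] pairwise disjoint sets (here: the
    sets nearly containing a vertex of colour [c]): there are [r] disjoint admissible
    sets, of sizes differing by at most 1, outside all [G c] and covering all
    but [(r - 1) * C] points. This statement is multiplicative in [r], because
    the sets containing [r1] disjoint members of [G c] contain no [r2] disjoint
    sets when [r = r1 * r2], so [r] may be taken prime.

    For prime [r], suppose there are no such sets. To an ordered family [X] of
    [r] disjoint sets attach the largest size of an equitable admissible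
    subfamily or, once this is large, the number of pairs [(j, c)] with [X j] in
    [G c]. This rank increases with [X] and is less than the number of points;
    when it does not change, neither does a nonconstant function of [j], on
    which the cyclic group acts freely as [r] is prime. This contradicts a
    Tucker lemma: every equivariant labelling of the simplices of the join of
    [n] copies of the cyclic group by group elements admits a full flag with no
    two consecutive labels equal. It holds because the standard cocycles of the
    group, which vanish on degenerate simplices, evaluate to 1 on an explicit
    cycle of the join modulo the group. *)

Set Implicit Arguments.
Unset Strict Implicit.
Unset Printing Implicit Defensive.
Import Order.TTheory GRing.Theory Num.Theory.

Local Open Scope ring_scope.

(** * Coboundaries of cochains on sequences, and barycentric subdivision *)

Section Coboundary.
Variables (V : eqType) (R : comPzRingType).
Implicit Types (f g : seq V -> R) (l v w : seq V).

(** The simplicial coboundary: the alternating sum of [f] over the faces of [l], with sign plus for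
    the deletion of the first vertex. *)
Fixpoint delta f l : R :=
  if l is x :: l' then f l' - delta (fun w => f (x :: w)) l' else 0.

Lemma eq_delta f g l :
  (forall w, (size w).+1 = size l -> subseq w l -> f w = g w) ->
  delta f l = delta g l.
Proof.
elim: l f g => //= x l IHl f g fg; congr (_ - _).
  by apply: fg => //; apply: subseq_cons.
by apply: IHl => w sw wl; apply: fg; rewrite /= ?sw ?eqxx.
Qed.

Lemma delta0 l : delta (fun=> 0) l = 0.
Proof. by elim: l => //= x l ->; rewrite subr0. Qed.

Lemma deltaB f g l : delta (fun w => f w - g w) l = delta f l - delta g l.
Proof.
elim: l f g => [|x l IHl] f g /=; first by rewrite subr0.
by rewrite IHl; ring.
Qed.

Lemma deltaZ a f l : delta (fun w => a * f w) l = a * delta f l.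
Proof.
elim: l f => [|x l IHl] f /=; first by rewrite mulr0.
by rewrite IHl; ring.
Qed.

Lemma delta_sum (I : finType) (F : I -> seq V -> R) l :
  delta (fun w => \sum_i F i w) l = \sum_i delta (F i) l.
Proof.
elim: l F => [|x l IHl] F /=; first by rewrite big1.
by rewrite (IHl (fun i w => F i (x :: w))) -sumrB.
Qed.

Lemma delta_delta f l : delta (delta f) l = 0.
Proof.
elim: l f => //= x l IHl f; rewrite deltaB opprB addrC subrK.
exact: IHl.
Qed.

End Coboundary.

Lemma delta_map (V U : eqType) (R : comPzRingType) (h : V -> U)
    (f : seq U -> R) l :
  delta f (map h l) = delta (fun w => f (map h w)) l.
Proof. by elim: l f => //= x l IHl f; rewrite IHl. Qed.

(* The cochain map dual to barycentric subdivision: [b v] is the label of the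
   barycentre of the simplex [v], and flags are listed from the top down. *)
Section Subdivision.
Variables (V U : eqType) (R : comPzRingType) (b : seq V -> U).
Implicit Types (psi phi : seq U -> R) (v w : seq V).

Fixpoint sd k psi v : R :=
  if k is k'.+1 then delta (sd k' (fun l => psi (b v :: l))) v else psi [::].

Lemma eq_sd k psi phi v :
  (forall l, size l = k -> psi l = phi l) -> sd k psi v = sd k phi v.
Proof.
elim: k psi phi v => [|k IHk] psi phi v eq_psi /=; first exact: eq_psi.
by apply: eq_delta => w _ _; apply: IHk => l sl; apply: eq_psi; rewrite /= sl.
Qed.

Lemma sdB k psi phi v :
  sd k (fun l => psi l - phi l) v = sd k psi v - sd k phi v.
Proof.
elim: k psi phi v => [|k IHk] psi phi v //=.
by rewrite -deltaB; apply: eq_delta => w _ _; apply: IHk.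
Qed.

Lemma sd_sum k (I : finType) (F : I -> seq U -> R) v :
  sd k (fun l => \sum_i F i l) v = \sum_i sd k (F i) v.
Proof.
elim: k F v => [|k IHk] F v //=.
by rewrite -delta_sum; apply: eq_delta => w _ _; apply: IHk.
Qed.

(** Deleting the barycentre of [v] from a flag leaves a flag in the boundary of [v]; the other faces
    yield, by induction, a coboundary, which the outer [delta] kills. *)
Lemma sd_delta k psi v :
  size v = k.+1 -> sd k.+1 (delta psi) v = delta (sd k psi) v.
Proof.
elim: k psi v => [|k IHk] psi v sv.
  by case: v sv => [|x []] //= _; rewrite !subr0.
transitivity (delta (fun w => sd k.+1 psi w -
    sd k.+1 (delta (fun l => psi (b v :: l))) w) v).
  by apply: eq_delta => w _ _; rewrite -sdB.
rewrite deltaB [X in _ - X](_ : _ = 0) ?subr0 //.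
rewrite -[RHS](delta_delta (sd k (fun l => psi (b v :: l))) v).
by apply: eq_delta => w sw _; apply: IHk; move: sw; rewrite sv => -[].
Qed.

Lemma sd_map k psi v (h : V -> V) (h' : U -> U) :
    (forall w, w != [::] -> b (map h w) = h' (b w)) -> size v = k ->
  sd k psi (map h v) = sd k (fun l => psi (map h' l)) v.
Proof.
move=> bh; elim: k psi v => [|k IHk] psi v sv //=.
rewrite delta_map bh; last by case: v sv.
apply: eq_delta => w sw _; rewrite IHk //.
by move: sw; rewrite sv => -[].
Qed.

(* Along a flag of [k] simplices with ranks in [1, k - 1], two consecutive
   ranks, hence two consecutive labels, coincide. *)
Lemma sd_normalized0 k psi v (ok : pred (seq V)) (rho : seq V -> nat) :
    (forall l1 x l2, psi (l1 ++ x :: x :: l2) = 0) ->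
    (forall w w', subseq w w' -> ok w' -> ok w) ->
    (forall w, ok w -> w != [::] -> 0 < rho w)%N ->
    (forall w w', ok w' -> w != [::] -> subseq w w' ->
      (rho w <= rho w')%N /\ (rho w = rho w' -> b w = b w')) ->
    ok v -> size v = k -> (rho v < k)%N -> sd k psi v = 0.
Proof.
move=> psi0 ok_sub rho_gt0 rho_mono.
elim: k psi v psi0 => [|k IHk] psi v psi0 okv sv rho_v //=.
rewrite -[RHS](delta0 R v); apply: eq_delta => w sw wv.
have {}sw : size w = k by move: sw; rewrite sv => -[].
have v0 : v != [::] by case: v sv {okv rho_v wv}.
have w0 : w != [::].
  by move: (rho_gt0 v okv v0) rho_v; rewrite -sw; case: (w) => //=; lia.
have okw := ok_sub _ _ wv okv.
have [le_rho eq_b] := rho_mono _ _ okv w0 wv.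
(* A drop in rank passes the bound on to the face [w]; without one, the label [b v] is repeated. *)
have [lt_rho|ge_rho] := ltnP (rho w) (rho v).
  by apply: IHk => // [l1 x l2|]; [rewrite -cat_cons psi0 | lia].
have bwv : b w = b v by apply: eq_b; lia.
case: k sw {IHk sv rho_v} => [|k] sw.
  by case: w sw w0 {wv okw le_rho ge_rho eq_b bwv}.
rewrite /= -[RHS](delta0 R w); apply: eq_delta => w' _ _.
transitivity (sd k (fun=> 0) w').
  by apply: eq_sd => l _; rewrite bwv (psi0 [::]).
by elim: (k) (w') => //= k' IH w2; rewrite -[RHS](delta0 R w2); apply: eq_delta.
Qed.

End Subdivision.

(** * Cocycles of the cyclic group *)

Section Cocycles.
Variable q : nat.
Local Notation Zp := 'I_q.+2.
Implicit Types (x y z t : Zp) (l : seq Zp).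

(* Indicator of a wrap-around between the representatives of [x] and [y]: its
   sum over an orbit is [y - x], and its coboundary [carry] is invariant. *)
Definition wrap_around x y : Zp := ((y < x)%N)%:R.

Definition carry x y z : Zp :=
  wrap_around y z - wrap_around x z + wrap_around x y.

Lemma wrap_aroundxx x : wrap_around x x = 0.
Proof. by rewrite /wrap_around ltnn. Qed.

Lemma val_succ x : val (x + 1) = (if x == q.+1 :> nat then 0 else x.+1)%N.
Proof.
rewrite /= (@modn_small 1) // addn1.
have [->|ne] := eqVneq; first by rewrite modnn.
by rewrite modn_small //; have := ltn_ord x; lia.
Qed.

(** Adding 1 preserves the order of representatives except that [q.+1] moves to 0. The correction is
    a coboundary, so it cancels in [carry]. *)
Lemma wrap_around_succ x y :
  wrap_around (x + 1) (y + 1) =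
  wrap_around x y - (x == q.+1 :> nat)%:R + (y == q.+1 :> nat)%:R.
Proof.
rewrite /wrap_around !val_succ; have ltx := ltn_ord x; have lty := ltn_ord y.
case: (eqVneq (x : nat) _) => [->|nx]; case: (eqVneq (y : nat) _) => [->|ny] //=.
- by rewrite ltnn /=; ring.
- rewrite (_ : (y < q.+1)%N); last by lia.
  by rewrite /=; ring.
- rewrite (_ : (q.+1 < x)%N = false); last by lia.
  by rewrite /=; ring.
- by rewrite ltnS subr0 addr0.
Qed.

Lemma shift_inv (A : Type) (f : Zp -> A) :
  (forall t, f (t + 1) = f t) -> forall t, f t = f 0.
Proof.
move=> f1 t; rewrite -[t]natr_Zp; elim: (t : nat) => // k IHk.
by rewrite -addn1 natrD f1.
Qed.

Lemma carry_shift t x y z : carry (x + t) (y + t) (z + t) = carry x y z.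
Proof.
pose f t := carry (x + t) (y + t) (z + t).
rewrite -[LHS]/(f t) (shift_inv (f := f)) /f ?addr0 // => {}t.
by rewrite !addrA /carry !wrap_around_succ; ring.
Qed.

(** After translation by [- x], the sum counts the [t] for which [(y - x) + t] wraps around; these
    are the last [y - x] representatives. *)
Lemma sum_wrap_around x y : \sum_t wrap_around (x + t) (y + t) = y - x.
Proof.
rewrite (reindex_inj (addrI (- x))) /=.
under eq_bigr => t _ do rewrite addrA subrr add0r addrA.
move: (y - x) => {x}y; pose m := val y.
rewrite /wrap_around -natr_sum.
have -> : (\sum_(t : Zp) ((y + t)%R < t)%N = m)%N.
  transitivity (\sum_(0 <= t < q.+2) (q.+2 - m <= t)%N)%N.
    rewrite big_mkord; apply: eq_bigr => t _ /=; congr nat_of_bool.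
    have ltt := ltn_ord t; have lty := ltn_ord y; rewrite -/m in lty *.
    case: (leqP q.+2 (m + t)%N) => h.
      by rewrite -(subnK h) modnDr modn_small; lia.
    by rewrite modn_small; lia.
  have lem : (m < q.+2)%N by apply: ltn_ord.
  rewrite (@big_cat_nat _ _ _ (q.+2 - m)%N) /=; [|lia|lia].
  rewrite big_nat big1 => [|i]; last by lia.
  rewrite big_nat (eq_bigr (fun=> 1%N)) => [|i]; last by lia.
  by rewrite -big_nat sum_nat_const_nat; lia.
by rewrite natr_Zp.
Qed.

(* Cocycles of the cyclic group in degrees [2k] and [2k + 1], on sequences of
   length [2k + 1] and [2k + 2] respectively; junk on other lengths. *)
Fixpoint theta_even k l : Zp :=
  if k is k'.+1 then
    if l is [:: x, y, z & l'] then carry x y z * theta_even k' (z :: l') else 0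
  else if l is [:: _] then 1 else 0.

Definition theta_odd k l : Zp :=
  if l is [:: x, y & l'] then (y - x) * theta_even k (y :: l') else 0.

Lemma theta_even_shift k t l :
  theta_even k (map (+%R^~ t) l) = theta_even k l.
Proof.
elim: k l => [|k IHk] [|x [|y [|z l]]] //=.
by rewrite carry_shift -[_ :: _]/(map (+%R^~ t) (z :: l)) IHk.
Qed.

(** Leibniz rule for a cup product: [carry] is the coboundary of [wrap_around]. That [theta_even k]
    is closed is a hypothesis because the induction proving it goes through this lemma. *)
Lemma delta_wrap_theta k l : size l = k.*2.+3 ->
  (forall l', size l' = k.*2.+2 -> delta (theta_even k) l' = 0) ->
  delta (fun l => if l is [:: x, y & l'] then
    wrap_around x y * theta_even k (y :: l') else 0) l = theta_even k.+1 l.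
Proof.
case: l => [|x [|y [|z l]]] //= [sl] th0.
have /= := th0 [:: y, z & l]; rewrite sl => /(_ erefl) /eqP.
rewrite subr_eq0 => /eqP th_eq.
rewrite -/(theta_even k).
have E : delta (fun w => wrap_around x y * theta_even k [:: y, z & w]) l =
  wrap_around x y * delta (fun w => theta_even k [:: y, z & w]) l by rewrite deltaZ.
rewrite E /carry th_eq; ring.
Qed.

(** For positive [k] the cochain is a coboundary, though of a cochain that is not invariant. *)
Lemma theta_even_cocycle k l :
  size l = k.*2.+2 -> delta (theta_even k) l = 0.
Proof.
elim: k l => [|k IHk] l sl.
  by case: l sl => [|x [|y []]] //= _; rewrite subr0 subrr.
rewrite -[RHS](delta_delta (fun l => if l is [:: x, y & l'] then
  wrap_around x y * theta_even k (y :: l') else 0) l).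
apply: eq_delta => w sw _; rewrite delta_wrap_theta //.
by move: sw; rewrite sl => -[].
Qed.

Lemma delta_wrap k l : size l = k.*2.+3 ->
  delta (fun l => if l is [:: x, y & l'] then
    wrap_around x y * theta_even k (y :: l') else 0) l = theta_even k.+1 l.
Proof.
by move=> sl; apply: delta_wrap_theta => // l'; apply: theta_even_cocycle.
Qed.

(** Leibniz rule again; here the primitive grows by [theta_even k] under a shift by 1. *)
Lemma delta_head k l : size l = k.*2.+2 ->
  delta (fun l => head 0 l * theta_even k l) l = theta_odd k l.
Proof.
move=> sl; have := theta_even_cocycle sl.
case: l sl => [|x [|y l]] //= _ /eqP; rewrite subr_eq0 => /eqP th_eq.
have E : delta (fun w => x * theta_even k [:: x, y & w]) l =
  x * delta (fun w => theta_even k [:: x, y & w]) l by rewrite deltaZ.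
by rewrite E th_eq; ring.
Qed.

(** Successive factors share an entry, so two neighbours always lie in one factor, and [carry]
    vanishes when neighbouring arguments agree. *)
Lemma theta_even_normalized k l1 x l2 :
  theta_even k (l1 ++ x :: x :: l2) = 0.
Proof.
elim: k l1 l2 => [|k IHk] l1 l2; first by case: l1 => [|? []].
case: l1 => [|y [|z [|z' l1]]] /=.
- by case: l2 => // z l2; rewrite /carry wrap_aroundxx addr0 subrr mul0r.
- by rewrite /carry wrap_aroundxx sub0r addNr mul0r.
- by rewrite (IHk [::]) mulr0.
- by rewrite (IHk (z' :: l1)) mulr0.
Qed.

Lemma theta_odd_normalized k l1 x l2 : theta_odd k (l1 ++ x :: x :: l2) = 0.
Proof.
case: l1 => [|y [|z l1]] /=; first by rewrite subrr mul0r.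
  by rewrite (theta_even_normalized k [::]) mulr0.
by rewrite (theta_even_normalized k (z :: l1)) mulr0.
Qed.

End Cocycles.

(** * Integration over a cycle of the join modulo rotation *)

Section Cycles.
Variables (q : nat) (T : eqType).
Local Notation Zp := 'I_q.+2.
Local Notation V := (T * Zp)%type.
Implicit Types (f F : seq V -> Zp) (s : seq T) (l v : seq V).

Definition rot_vertex (t : Zp) (x : V) : V := (x.1, x.2 + t).

Lemma rot_vertexD t u l :
  map (rot_vertex t) (map (rot_vertex u) l) = map (rot_vertex (u + t)) l.
Proof.
by rewrite -map_comp; apply: eq_map => x; rewrite /rot_vertex /= addrA.
Qed.

Lemma rot_vertex_fst t l : map fst (map (rot_vertex t) l) = map fst l.
Proof. by rewrite -map_comp. Qed.

(* With [g] the generator of the cyclic group, the norm [1 + g + g^2 + ...] for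
   positive even [m], and [g - 1] for odd [m]. *)
Definition transfer (m : nat) F l : Zp :=
  if m == 0%N then F l
  else if odd m then F (map (rot_vertex 1) l) - F l
  else \sum_t F (map (rot_vertex t) l).

(* Integration over a chain in the join of copies of [Zp] indexed by [s]; its
   boundary is the transfer of the chain for the tail of [s], so that it is a
   cycle modulo the action of [Zp]. *)
Fixpoint cycle_eval s f : Zp :=
  if s is a :: s' then
    cycle_eval s' (transfer (size s') (fun l => f ((a, 0) :: l)))
  else f [::].

Lemma eq_transfer m F F' l : (forall w, map fst w = map fst l -> F w = F' w) ->
  transfer m F l = transfer m F' l.
Proof.
move=> eqF; rewrite /transfer; case: ifP => _; first exact: eqF.
case: ifP => _; first by rewrite !eqF ?rot_vertex_fst.
by apply: eq_bigr => t _; rewrite eqF ?rot_vertex_fst.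
Qed.

Lemma eq_cycle_eval s f f' : (forall l, map fst l = s -> f l = f' l) ->
  cycle_eval s f = cycle_eval s f'.
Proof.
elim: s f f' => [|a s IHs] f f' eqf /=; first exact: eqf.
apply: IHs => l ls; apply: eq_transfer => w wl.
by apply: eqf; rewrite /= wl ls.
Qed.

Lemma transferB m F F' l :
  transfer m (fun w => F w - F' w) l = transfer m F l - transfer m F' l.
Proof.
rewrite /transfer; case: ifP => // _; case: ifP => _; first by ring.
by rewrite sumrB.
Qed.

Lemma cycle_evalB s f f' :
  cycle_eval s (fun w => f w - f' w) = cycle_eval s f - cycle_eval s f'.
Proof.
elim: s f f' => //= a s IHs f f'; rewrite -IHs.
by apply: eq_cycle_eval => l _; rewrite transferB.
Qed.

Lemma cycle_eval0 s : cycle_eval s (fun=> 0) = 0.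
Proof.
rewrite -[RHS](subrr (cycle_eval s (fun=> 0))) -cycle_evalB.
by apply: eq_cycle_eval => l _; rewrite subrr.
Qed.

Lemma transfer_delta m F l : transfer m (delta F) l = delta (transfer m F) l.
Proof.
rewrite /transfer; case: ifP => // _; case: ifP => _.
  by rewrite delta_map deltaB.
by rewrite delta_sum; apply: eq_bigr => t _; rewrite delta_map.
Qed.

(** The norm is invariant under rotation, so its product with [g - 1] is zero in either order. *)
Lemma transfer_transfer m F l : transfer m.+1 (transfer m.+2 F) l = 0.
Proof.
rewrite /transfer /= negbK; case: (odd m) => /=.
  under eq_bigr => t _ do rewrite rot_vertexD.
  rewrite sumrB; apply/eqP; rewrite subr_eq0; apply/eqP.
  by rewrite [RHS](reindex_inj (addIr 1)).
rewrite (reindex_inj (addrI (-1))) /= -sumrB big1 // => t _.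
by rewrite rot_vertexD addrA subrr add0r subrr.
Qed.

(** Stokes' formula: the face opposite to the first vertex gives the right-hand side, and the faces
    through that vertex cancel. *)
Lemma cycle_eval_delta a s f :
  cycle_eval (a :: s) (delta f) = cycle_eval s (transfer (size s) f).
Proof.
rewrite /= -[RHS]subr0.
pose f' l := f ((a, 0) :: l).
transitivity (cycle_eval s (transfer (size s) f) -
              cycle_eval s (transfer (size s) (delta f'))).
  by rewrite -cycle_evalB; apply: eq_cycle_eval => l _; rewrite -transferB.
congr (_ - _).
rewrite (eq_cycle_eval (f' := delta (transfer (size s) f'))); last first.
  by move=> l _; apply: transfer_delta.
(* Peeling off one more vertex leaves two consecutive transfers, which compose to zero. *)
elim: s {f} f' => //= a' s IHs F.
pose F1 := transfer (size s).+1 F; pose F2 l := F1 ((a', 0) :: l).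
transitivity (cycle_eval s (transfer (size s) F1) -
              cycle_eval s (transfer (size s) (delta F2))).
  by rewrite -cycle_evalB; apply: eq_cycle_eval => l _; rewrite -transferB.
rewrite [X in _ - X](eq_cycle_eval (f' := delta (transfer (size s) F2))); last first.
  by move=> l _; apply: transfer_delta.
(* Rotation fixes the empty sequence, so at the end [g - 1] alone gives zero. *)
rewrite IHs subr0 /F1; case: s {IHs F1 F2} => [|b s].
  by rewrite /= /transfer /= subrr.
rewrite -[RHS](cycle_eval0 (b :: s)); apply: eq_cycle_eval => l _.
exact: transfer_transfer.
Qed.

End Cycles.

(** * The Tucker lemma for flags of simplices *)

Section TuckerSeq.
Variables (q : nat) (T : eqType).
Local Notation Zp := 'I_q.+2.
Local Notation V := (T * Zp)%type.
Variable b : seq V -> Zp.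
Hypothesis b_rot : forall t v, v != [::] -> b (map (rot_vertex t) v) = b v + t.
Implicit Types (s : seq T) (v : seq V).

Lemma cycle_eval_sd_delta a s psi phi :
    (forall l, size l = (size s).+1 -> delta psi l = phi l) ->
  cycle_eval (a :: s) (sd b (size s).+1 phi) =
  cycle_eval s (transfer (size s) (sd b (size s) psi)).
Proof.
move=> dpsi; rewrite -(cycle_eval_delta a); apply: eq_cycle_eval => l ls.
rewrite -sd_delta; last by rewrite -(size_map fst) ls.
by apply: eq_sd => w sw; rewrite dpsi.
Qed.

(** Stokes' formula for the primitive in [delta_head]: the transfer is [g - 1], and a shift by 1
    adds [theta_even k] to the primitive. *)
Lemma cycle_eval_theta_odd a s k : size s = k.*2.+1 ->
  cycle_eval (a :: s) (sd b (size s).+1 (theta_odd k)) =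
  cycle_eval s (sd b (size s) (theta_even k)).
Proof.
move=> ss.
rewrite (@cycle_eval_sd_delta _ _ (fun l => head 0 l * theta_even k l)); last first.
  by move=> l; rewrite ss; apply: delta_head.
apply: eq_cycle_eval => l ls; have sl : size l = size s by rewrite -ls size_map.
have [s0 s1] : (size s == 0%N) = false /\ odd (size s) by rewrite ss /= odd_double.
rewrite /transfer s0 s1 (@sd_map _ _ _ _ _ _ _ _ (+%R^~ 1) (@b_rot 1)) //.
rewrite -sdB; apply: eq_sd => w; rewrite ss => sw.
by rewrite theta_even_shift; case: w sw => //= x w _; ring.
Qed.

(** Stokes' formula for the primitive in [delta_wrap]: the transfer is the norm, and summing
    [wrap_around] over an orbit gives the factor [y - x] of [theta_odd]. *)
Lemma cycle_eval_theta_even a s k : size s = k.*2.+2 ->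
  cycle_eval (a :: s) (sd b (size s).+1 (theta_even k.+1)) =
  cycle_eval s (sd b (size s) (theta_odd k)).
Proof.
move=> ss.
rewrite (@cycle_eval_sd_delta _ _ (fun l =>
  if l is [:: x, y & l'] then wrap_around x y * theta_even k (y :: l') else 0)); last first.
  by move=> l; rewrite ss; apply: delta_wrap.
apply: eq_cycle_eval => l ls; have sl : size l = size s by rewrite -ls size_map.
have [s0 s1] : (size s == 0%N) = false /\ odd (size s) = false.
  by rewrite ss /= odd_double.
rewrite /transfer s0 s1.
under eq_bigr => t _ do
  rewrite (@sd_map _ _ _ _ _ _ _ _ (+%R^~ t) (@b_rot t)) //.
rewrite -sd_sum; apply: eq_sd => w; rewrite ss; case: w => [|x [|y w]] //= _.
rewrite -sum_wrap_around mulr_suml; apply: eq_bigr => t _.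
by rewrite -[_ :: _]/(map (+%R^~ t) (y :: w)) theta_even_shift.
Qed.

(** The two reductions alternate down to a single vertex, where [theta_even 0] is 1. *)
Lemma cycle_eval_theta s k :
  (size s = k.*2.+1 -> cycle_eval s (sd b (size s) (theta_even k)) = 1) /\
  (size s = k.*2.+2 -> cycle_eval s (sd b (size s) (theta_odd k)) = 1).
Proof.
have even_odd s' j :
    (forall s, size s = j.*2.+1 ->
       cycle_eval s (sd b (size s) (theta_even j)) = 1) ->
    size s' = j.*2.+2 -> cycle_eval s' (sd b (size s') (theta_odd j)) = 1.
  case: s' => // a s' IH [ss]; rewrite [size (a :: s')]/=.
  by rewrite cycle_eval_theta_odd // IH.
suff even1 : forall j s, size s = j.*2.+1 ->
    cycle_eval s (sd b (size s) (theta_even j)) = 1.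
  by split; [apply: even1 | apply: even_odd; apply: even1].
elim=> [|j IHj] s'.
  by case: s' => [|a []] //= _; rewrite /transfer /= subr0.
case: s' => // a s' [ss]; rewrite [size (a :: s')]/=.
by rewrite cycle_eval_theta_even // even_odd.
Qed.

(** Ranks below [size s] would make every normalized cochain integrate to 0 by [sd_normalized0], but
    the cocycle of matching degree integrates to 1. *)
Lemma tucker_seq s (rho : seq V -> nat) :
    s != [::] ->
    (forall v, subseq (map fst v) s -> v != [::] -> 0 < rho v)%N ->
    (forall v w, subseq (map fst w) s -> v != [::] -> subseq v w ->
      (rho v <= rho w)%N /\ (rho v = rho w -> b v = b w)) ->
  ~ (forall v, map fst v = s -> rho v < size s)%N.
Proof.
move=> s0 rho_gt0 rho_mono rho_lt.
have sd0 psi : (forall l1 x l2, psi (l1 ++ x :: x :: l2) = 0) ->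
    cycle_eval s (sd b (size s) psi) = 0.
  move=> psi0; rewrite -(cycle_eval0 q s); apply: eq_cycle_eval => v vs.
  apply: (@sd_normalized0 _ _ _ b _ _ v (fun v => subseq (map fst v) s) rho) => //.
  - by move=> w w' ww'; apply: subseq_trans; apply: map_subseq.
  - by rewrite vs.
  - by rewrite -vs size_map.
  - exact: rho_lt.
have := odd_double_half (size s).-1.
case: (odd _) => /= e.
  have ss : size s = (size s).-1./2.*2.+2 by case: (s) s0 e => //= *; lia.
  have [_ /(_ ss)/eqP] := cycle_eval_theta s (size s).-1./2.
  by rewrite sd0 1?eq_sym ?oner_eq0 // => *; apply: theta_odd_normalized.
have ss : size s = (size s).-1./2.*2.+1 by case: (s) s0 e => //= *; lia.
have [/(_ ss)/eqP + _] := cycle_eval_theta s (size s).-1./2.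
by rewrite sd0 1?eq_sym ?oner_eq0 // => *; apply: theta_even_normalized.
Qed.

End TuckerSeq.

(** * Rotation of families, and the Tucker lemma for disjoint families *)

Definition disjoint_family (T J : finType) (D : {set T})
    (X : {ffun J -> {set T}}) :=
  [forall j, X j \subset D] &&
  [forall i, forall j, (i != j) ==> [disjoint X i & X j]].

Lemma disjoint_familyP (T J : finType) (D : {set T}) (X : {ffun J -> {set T}}) :
  reflect ((forall j, X j \subset D) /\ forall i j, i != j -> [disjoint X i & X j])
          (disjoint_family D X).
Proof.
apply: (iffP andP) => -[XD Xd]; split.
- exact/forallP.
- by move=> i j; move/forallP/(_ i)/forallP/(_ j)/implyP: Xd.
- exact/forallP.
- by apply/forallP => i; apply/forallP => j; apply/implyP; apply: Xd.
Qed.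

Section Rotation.
Variable q : nat.
Local Notation Zp := 'I_q.+2.

Definition rot_fun (W : Type) (t : Zp) (k : {ffun Zp -> W}) : {ffun Zp -> W} :=
  [ffun j => k (j - t)].

Definition nonconstant (W : eqType) (k : {ffun Zp -> W}) :=
  [exists i, exists j, k i != k j].

Lemma rot_funD (W : Type) t u (k : {ffun Zp -> W}) :
  rot_fun t (rot_fun u k) = rot_fun (u + t) k.
Proof. by apply/ffunP => j; rewrite !ffunE opprD addrA addrAC. Qed.

Lemma rot_fun0 (W : Type) (k : {ffun Zp -> W}) : rot_fun 0 k = k.
Proof. by apply/ffunP => j; rewrite !ffunE subr0. Qed.

Lemma nonconstant_rot (W : eqType) t (k : {ffun Zp -> W}) :
  nonconstant (rot_fun t k) = nonconstant k.
Proof.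
apply/existsP/existsP => -[i /existsP[j kij]].
  by exists (i - t); apply/existsP; exists (j - t); move: kij; rewrite !ffunE.
by exists (i + t); apply/existsP; exists (j + t); rewrite !ffunE !addrK.
Qed.

(** A nonzero [t] generates the group of prime order, and would make [k] constant. *)
Lemma rot_fun_free (W : eqType) t (k : {ffun Zp -> W}) :
  prime q.+2 -> nonconstant k -> rot_fun t k = k -> t = 0.
Proof.
move=> pr /existsP[i /existsP[j kij]] tk; apply/eqP; apply: contraNT kij => t0.
have rotn m : rot_fun (t *+ m) k = k.
  by elim: m => [|m IHm]; rewrite ?rot_fun0 // mulrSr -rot_funD IHm.
have tU : t \is a GRing.unit.
  rewrite -[t]natr_Zp (@unitZpE q.+2) // prime_coprime //.
  apply: contra t0 => pt; case: (posnP t) => [t0|t_gt0]; first exact/eqP/val_inj.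
  by have := dvdn_leq t_gt0 pt; rewrite leqNgt ltn_ord.
have /ffunP/(_ i) := rotn ((i - j) / t : Zp).
rewrite ffunE -mulr_natl natr_Zp divrK // => <-.
by rewrite opprB addrC subrK.
Qed.

(** The action is free on nonconstant functions, so a representative identifies each orbit with the
    group. *)
Lemma equivariant_sign (W : finType) : prime q.+2 ->
  exists g : {ffun Zp -> W} -> Zp,
    forall k t, nonconstant k -> g (rot_fun t k) = g k + t.
Proof.
move=> pr; pose orb (k k' : {ffun Zp -> W}) := [exists t, k' == rot_fun t k].
pose rep k := choose (orb k) k.
pose g k := odflt 0 [pick t | k == rot_fun t (rep k)].
have orbxx k : orb k k by apply/existsP; exists 0; rewrite rot_fun0.
have rep_rot k t : rep (rot_fun t k) = rep k.
  have eq_orb : orb (rot_fun t k) =1 orb k.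
    move=> k'; apply/existsP/existsP => -[u /eqP->].
      by exists (t + u); rewrite rot_funD.
    by exists (u - t); rewrite rot_funD addrC subrK.
  by rewrite /rep (eq_choose eq_orb); apply: choose_id; rewrite // -eq_orb.
have gP k : k = rot_fun (g k) (rep k).
  rewrite /g; case: pickP => [t /eqP //|].
  have /existsP[t /eqP rept] := chooseP (orbxx k).
  by move=> /(_ (- t)); rewrite /rep rept rot_funD subrr rot_fun0 eqxx.
exists g => k t nk; apply/eqP; rewrite -subr_eq0; apply/eqP.
have nrep : nonconstant (rep k) by move: nk; rewrite {1}(gP k) nonconstant_rot.
apply: (rot_fun_free pr nrep).
have := gP (rot_fun t k); rewrite rep_rot [in LHS](gP k) rot_funD => e.
apply: (@can_inj _ _ (rot_fun (g k + t)) (rot_fun (- (g k + t)))).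
  by move=> k'; rewrite rot_funD subrr rot_fun0.
by rewrite rot_funD subrK.
Qed.

(* The topological input: [rho] together with the sign deduced from [key]
   would be an equivariant simplicial map to a join of fewer than [#|D|] copies
   of the cyclic group. *)
Lemma tucker_family (T W : finType) (D : {set T})
    (rho : {ffun Zp -> {set T}} -> nat)
    (key : {ffun Zp -> {set T}} -> {ffun Zp -> W}) :
    prime q.+2 -> D != set0 ->
    (forall t X, key (rot_fun t X) = rot_fun t (key X)) ->
    (forall X : {ffun Zp -> {set T}}, disjoint_family D X ->
      [exists j, X j != set0] ->
      (0 < rho X)%N /\ nonconstant (key X)) ->
    (forall X Y : {ffun Zp -> {set T}}, disjoint_family D Y -> [exists j, X j != set0] ->
      (forall j, X j \subset Y j) ->
      (rho X <= rho Y)%N /\ (rho X = rho Y -> key X = key Y)) ->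
  exists2 X : {ffun Zp -> {set T}}, disjoint_family D X & (#|D| <= rho X)%N.
Proof.
move=> pr D0 key_rot rhoP rho_mono.
apply/exists_inP; apply: contraT => /exists_inPn no.
have [g gP] := equivariant_sign W pr.
pose fam (v : seq (T * Zp)) := [ffun j : Zp => [set a | (a, j) \in v]].
(* Nonempty simplices of the join have a nonconstant key; the fallback keeps [b] equivariant on the
   other nonempty sequences. *)
pose b v := if nonconstant (key (fam v)) then g (key (fam v))
            else if v is x :: _ then x.2 else 0.
have fam_rot t v : fam (map (rot_vertex t) v) = rot_fun t (fam v).
  apply/ffunP => j; rewrite !ffunE; apply/setP => a; rewrite !inE.
  apply/mapP/idP => [[[a' j'] v' [-> ->]]|v']; first by rewrite addrK.
  by exists (a, j - t); rewrite // /rot_vertex /= subrK.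
have b_rot t v : v != [::] -> b (map (rot_vertex t) v) = b v + t.
  rewrite /b fam_rot key_rot nonconstant_rot; case: ifP => [nk _|_]; first exact: gP.
  by case: v.
have fam_neq0 v : v != [::] -> [exists j, fam v j != set0].
  case: v => // -[a j] v _; apply/existsP; exists j; rewrite ffunE.
  by apply/set0Pn; exists a; rewrite inE mem_head.
have fam_disjoint v : subseq (map fst v) (enum D) -> disjoint_family D (fam v).
  move=> vD; apply/disjoint_familyP; split => [j|i j ij].
    apply/subsetP => a; rewrite ffunE inE => /(map_f fst)/(mem_subseq vD).
    by rewrite mem_enum.
  rewrite disjoints_subset; apply/subsetP => a; rewrite !ffunE !inE => ai.
  apply: contra ij => aj; have /= uv := subseq_uniq vD (enum_uniq _).
  pose x0 := (a, i); have := uniqP a uv; rewrite size_map => inj.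
  have eq_ind : index (a, i) v = index (a, j) v.
    by apply: inj; rewrite ?inE ?index_mem // !(nth_map x0) ?index_mem // !nth_index.
  by have := nth_index x0 ai; rewrite eq_ind nth_index // => -[->].
case: (tucker_seq b_rot (s := enum D) (rho := fun v => rho (fam v))).
- by rewrite -size_eq0 -cardE cards_eq0.
- by move=> v vD v0; have [] := rhoP _ (fam_disjoint v vD) (fam_neq0 v v0).
- move=> v w wD v0 vw.
  have sub j : fam v j \subset fam w j.
    by rewrite !ffunE; apply/subsetP => a; rewrite !inE; apply: mem_subseq.
  have vD : subseq (map fst v) (enum D) by apply: subseq_trans wD; apply: map_subseq.
  have w0 : w != [::] by apply: contraNneq v0 => w0; move: vw; rewrite w0 subseq0.
  have [le_rho eq_key] := rho_mono _ _ (fam_disjoint w wD) (fam_neq0 v v0) sub.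
  split=> // /eq_key; rewrite /b => <-.
  by have [_ ->] := rhoP _ (fam_disjoint v vD) (fam_neq0 v v0).
- move=> v vD; rewrite -cardE ltnNge; apply: no.
  by apply: fam_disjoint; rewrite vD.
Qed.

End Rotation.

(** * Sizes of equitable families *)

Section Levels.
Variables (J : finType) (j0 : J).
Implicit Types a : J -> nat.
Local Open Scope nat_scope.

Definition least a := a [arg min_(j < j0) a j].

Lemma least_le a j : least a <= a j.
Proof. by rewrite /least; case: arg_minnP => // i _; apply. Qed.

Lemma least_ex a : exists j, a j = least a.
Proof. by exists [arg min_(j < j0) a j]. Qed.

(* The largest total size of an equitable family with j-th size at most [a j]. *)
Definition level a := \sum_j minn (a j) (least a).+1.

Lemma least_mono a a' : (forall j, a j <= a' j) -> least a <= least a'.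
Proof.
move=> le_a; have [j <-] := least_ex a'.
exact: leq_trans (least_le a j) (le_a j).
Qed.

Lemma level_mono a a' : (forall j, a j <= a' j) -> level a <= level a'.
Proof.
move=> le_a; apply: leq_sum => j _.
by have := least_mono le_a; have := le_a j; lia.
Qed.

Lemma eq_leq_sum (a a' : J -> nat) : (forall j, a j <= a' j) ->
  \sum_j a j = \sum_j a' j -> forall j, a j = a' j.
Proof.
move=> le_a e j.
have [_] := leqif_sum (P := predT) (fun j _ => leqif_eq (le_a j)).
by rewrite e eqxx => /esym/forallP/(_ j)/eqP.
Qed.

(** The truncated sizes are monotone, so equal totals make them agree termwise; an index where [a]
    is least then shows that the two minima agree. *)
Lemma eq_level a a' : (forall j, a j <= a' j) -> level a = level a' ->
  forall j, (least a < a j) = (least a' < a' j).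
Proof.
move=> le_a e j; have le_m := least_mono le_a.
have eq_min : forall i, minn (a i) (least a).+1 = minn (a' i) (least a').+1.
  by apply: eq_leq_sum => // i; have := le_a i; lia.
have [i ai] := least_ex a.
have := eq_min i; have := eq_min j; have := least_le a' i; have := least_le a' j.
by have := least_le a j; lia.
Qed.

Lemma eq_level_least a a' : (forall j, a j <= a' j) -> level a = level a' ->
  least a = least a'.
Proof.
move=> le_a e; have le_m := least_mono le_a.
have eq_min : forall i, minn (a i) (least a).+1 = minn (a' i) (least a').+1.
  by apply: eq_leq_sum => // i; have := le_a i; lia.
have [i ai] := least_ex a.
by have := eq_min i; have := least_le a' i; lia.
Qed.

Lemma level_gt0 a j : 0 < a j -> 0 < level a.
Proof. by move=> aj; rewrite /level (bigD1 j) //=; lia. Qed.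

(** The truncated sizes are equitable with total [level a], and lowering a largest entry by one
    keeps them so. *)
Lemma level_equitable a N : N <= level a -> exists b : J -> nat,
  [/\ forall j, b j <= a j, forall i j, b i <= b j + 1 & \sum_j b j = N].
Proof.
move=> leN; rewrite -(subKn leN).
elim: (_ - N) => [|d [b [ba bb sb]]].
  exists (fun j => minn (a j) (least a).+1); split=> [j|i j|]; first lia.
    by have := least_le a j; lia.
  by rewrite subn0.
have [s0|s_gt0] := posnP (\sum_j b j); first by exists b; split=> //; lia.
pose i := [arg max_(i > j0) b i].
have bi j : b j <= b i by rewrite /i; case: arg_maxnP => // k _; apply.
have bi0 : 0 < b i.
  rewrite lt0n; apply/negP => /eqP bi0; move: s_gt0; rewrite big1 // => j _.
  by have := bi j; lia.
exists (fun j => b j - (j == i)); split=> [j|j k|].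
- by have := ba j; lia.
- have := bi j; have := bi k; have := bb j k; have := bb i k.
  by case: eqP => [->|]; case: eqP => [->|]; lia.
- move: sb; rewrite (bigD1 i) //= [\sum_j _](bigD1 i) //= eqxx.
  rewrite [X in _ - 1 + X](eq_bigr b) => [|j /negPf ->]; last lia.
  by lia.
Qed.

End Levels.

(** * Equitable transversal families avoiding the [G c] *)

Local Open Scope nat_scope.

Lemma transversal_of_size (T K : finType) (pi : T -> K) (A : {set T}) m :
  m <= #|pi @: A| -> exists B : {set T},
    [/\ B \subset A, #|pi @: B| = m & #|B| = m].
Proof.
elim: m => [|m IHm] lem; first by exists set0; rewrite sub0set imset0 !cards0.
have [B [BA cpB cB]] := IHm (ltnW lem).
have /subsetPn[k /imsetP[x xA ->{k}] kB] : ~~ (pi @: A \subset pi @: B).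
  by apply: contraL lem => /subset_leq_card; rewrite cpB -leqNgt.
have xB : x \notin B by apply: contra kB; apply: imset_f.
exists (x |: B); rewrite subUset sub1set xA BA imsetU1 !cardsU1 kB xB cpB cB.
by [].
Qed.

Lemma card_bigcup_disjoint (T J : finType) (X : J -> {set T}) :
  (forall i j, i != j -> [disjoint X i & X j]) ->
  #|\bigcup_j X j| = \sum_j #|X j|.
Proof.
move=> dX; rewrite -sum1_card (partition_disjoint_bigcup addn _ dX).
by apply: eq_bigr => j _; rewrite sum1_card.
Qed.

Section Spread.
Variables (T K J : finType) (pi : T -> K) (C : nat) (G : 'I_C -> {set {set T}}).
Variable D : {set T}.

Definition spread (N : nat) (X : {ffun J -> {set T}}) :=
  [&& disjoint_family D X, [forall j, #|pi @: X j| == #|X j|],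
      [forall j, forall c, X j \notin G c],
      [forall i, forall j, #|X i| <= #|X j| + 1] & \sum_j #|X j| == N].

Lemma spreadP N X : reflect
  [/\ disjoint_family D X, forall j, {in X j &, injective pi},
      forall j c, X j \notin G c, forall i j, #|X i| <= #|X j| + 1
    & \sum_j #|X j| = N] (spread N X).
Proof.
apply: (iffP and5P);
  move=> [dX]; [move=> /forallP tX /forallP bX /forallP eX /eqP sX|move=> tX bX eX sX].
  split=> // [j|j|i]; [exact/imset_injP | exact/forallP | exact/forallP].
split=> //; last exact/eqP.
- by apply/forallP => j; apply/imset_injP.
- by apply/forallP => j; apply/forallP.
- by apply/forallP => j; apply/forallP.
Qed.

End Spread.

Definition label_class (T K : finType) (pi : T -> K) (D : {set T}) k :=
  [set x in D | pi x == k].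

(* The combinatorial core of the theorem, for [#|J|]-uniform hypergraphs: [G c]
   collects the sets (nearly) containing a vertex of colour [c]. In contrast to
   the chromatic bound itself, this form is multiplicative in [#|J|]. *)
Definition spreadable (J : finType) : Prop :=
  forall (T K : finType) (pi : T -> K) (C : nat) (G : 'I_C -> {set {set T}})
    (D : {set T}),
  (forall c (A B : {set T}), A \subset B -> A \in G c -> B \in G c) ->
  (forall k, #|label_class pi D k| <= #|J|) ->
  (forall c (X : {ffun J -> {set T}}),
     disjoint_family D X -> ~~ [forall j, X j \in G c]) ->
  exists X : {ffun J -> {set T}}, spread pi G D (#|D| - #|J|.-1 * C) X.

(** * A prime number of parts *)

Section PrimeCase.
Variable q : nat.
Local Notation Zp := 'I_q.+2.
Hypothesis q_prime : prime q.+2.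
Variables (T K : finType) (pi : T -> K) (C : nat) (G : 'I_C -> {set {set T}}).
Variable D : {set T}.
Hypothesis G_up : forall c (A B : {set T}), A \subset B -> A \in G c -> B \in G c.
Hypothesis D_small : forall k, #|label_class pi D k| <= q.+2.
Hypothesis G_disjoint : forall c (X : {ffun Zp -> {set T}}),
  disjoint_family D X -> ~~ [forall j, X j \in G c].
Implicit Types X Y : {ffun Zp -> {set T}}.

Let nlab X j := #|pi @: X j|.
Let nu X := level ord0 (nlab X).
Let col X j := [set c | X j \in G c].

Lemma nlab_rot t X j : nlab (rot_fun t X) j = nlab X (j - t)%R.
Proof. by rewrite /nlab ffunE. Qed.

Lemma least_rot t X : least ord0 (nlab (rot_fun t X)) = least ord0 (nlab X).
Proof.
apply/eqP; rewrite eqn_leq; apply/andP; split.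
  have [j <-] := least_ex ord0 (nlab X).
  by rewrite -[j](addrK t) -nlab_rot least_le.
by have [j <-] := least_ex ord0 (nlab (rot_fun t X)); rewrite nlab_rot least_le.
Qed.

Lemma nu_rot t X : nu (rot_fun t X) = nu X.
Proof.
rewrite /nu /level least_rot (reindex_inj (addIr t)) /=.
by apply: eq_bigr => j _; rewrite nlab_rot addrK.
Qed.

(** Each case is used when the previous function of [j] is constant; the last one is nonconstant for
    disjoint parts that are not all empty. *)
Let low_key X : {ffun Zp -> bool + {set K} + {set T}} :=
  if [exists j, least ord0 (nlab X) < nlab X j]
  then [ffun j => inl (inl (least ord0 (nlab X) < nlab X j))]
  else if [exists i, exists j, pi @: X i != pi @: X j]
  then [ffun j => inl (inr (pi @: X j))]
  else [ffun j => inr (X j)].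

Lemma low_key_rot t X : low_key (rot_fun t X) = rot_fun t (low_key X).
Proof.
rewrite /low_key least_rot.
have -> : [exists j, least ord0 (nlab X) < nlab (rot_fun t X) j] =
          [exists j, least ord0 (nlab X) < nlab X j].
  apply/existsP/existsP => -[j]; first by rewrite nlab_rot => ?; exists (j - t)%R.
  by exists (j + t)%R; rewrite nlab_rot addrK.
case: ifP => _; first by apply/ffunP => j; rewrite !ffunE nlab_rot.
have -> : [exists i, exists j, pi @: rot_fun t X i != pi @: rot_fun t X j] =
          [exists i, exists j, pi @: X i != pi @: X j].
  apply/existsP/existsP => -[i /existsP[j ij]].
    by exists (i - t)%R; apply/existsP; exists (j - t)%R; move: ij; rewrite !ffunE.
  by exists (i + t)%R; apply/existsP; exists (j + t)%R; rewrite !ffunE !addrK.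
by case: ifP => _; apply/ffunP => j; rewrite !ffunE.
Qed.

Lemma low_key_nonconstant X :
  disjoint_family D X -> [exists j, X j != set0] -> nonconstant (low_key X).
Proof.
move=> /disjoint_familyP[_ dX] /existsP[i Xi]; rewrite /low_key.
case: existsP => [[j ltj]|_].
  have [k ek] := least_ex ord0 (nlab X).
  apply/existsP; exists j; apply/existsP; exists k.
  by rewrite !ffunE ltj -ek ltnn.
case: existsP => [[j /existsP[k jk]]|_].
  by apply/existsP; exists j; apply/existsP; exists k; rewrite !ffunE.
apply/existsP; exists i; apply/existsP; exists (i + 1)%R; rewrite !ffunE.
have i1 : i != (i + 1)%R by rewrite -subr_eq0 opprD addNKr oppr_eq0 oner_eq0.
apply/negP => /eqP[eX]; move: (dX _ _ i1); rewrite -eX -setI_eq0 setIid.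
exact/negP.
Qed.

Lemma eq_low_key X Y : disjoint_family D Y -> (forall j, X j \subset Y j) ->
  nu X = nu Y -> low_key X = low_key Y.
Proof.
move=> /disjoint_familyP[YD dY] XY eq_nu.
have pXY j : pi @: X j \subset pi @: Y j by apply: imsetS.
have le_nlab j : nlab X j <= nlab Y j by apply: subset_leq_card.
have eq_lt := eq_level le_nlab eq_nu.
have eq_m := eq_level_least le_nlab eq_nu.
rewrite /low_key; under eq_existsb => j do rewrite eq_lt.
case: ifP => [_|/negbT/existsPn no_lt].
  by apply/ffunP => j; rewrite !ffunE eq_lt.
have nlabY j : nlab Y j = least ord0 (nlab Y).
  by have := no_lt j; have := least_le ord0 (nlab Y) j; lia.
have nlabX j : nlab X j = least ord0 (nlab X).
  by have := no_lt j; rewrite -eq_lt; have := least_le ord0 (nlab X) j; lia.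
have eq_pi j : pi @: X j = pi @: Y j.
  by apply/eqP; rewrite eqEcard pXY -!/(nlab _ _) nlabX nlabY eq_m leqnn.
under eq_existsb => i do under eq_existsb => j do rewrite !eq_pi.
case: ifP => [_|/negbT/existsPn no_neq].
  by apply/ffunP => j; rewrite !ffunE eq_pi.
pose L := pi @: Y ord0.
have piY j : pi @: Y j = L.
  by have /existsPn/(_ ord0) := no_neq j; rewrite negbK => /eqP.
(* Every label of [L] occurs in all q.+2 parts, so its class is exhausted. *)
have sumY : \sum_j #|Y j| <= \sum_(j : Zp) #|L|.
  rewrite sum_nat_const card_ord mulnC -card_bigcup_disjoint // -sum1_card.
  rewrite (partition_big pi (mem L)) => [|x /bigcupP[j _ xY]]; last first.
    by rewrite /= -(piY j) imset_f.
  rewrite -sum_nat_const; apply: leq_sum => k _; apply: leq_trans (D_small k).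
  rewrite sum1dep_card subset_leq_card //; apply/subsetP => x; rewrite !inE.
  by case/andP => /bigcupP[j _ /(subsetP (YD j))->].
have leY j : #|L| <= #|Y j| by rewrite -(piY j) leq_imset_card.
have cardY : forall j, #|L| = #|Y j|.
  apply: eq_leq_sum => //; apply/eqP; rewrite eqn_leq sumY andbT.
  exact: leq_sum.
(* [Y j] has exactly one point per label in [L], and its subset [X j] already shows all these
   labels. *)
apply/ffunP => j; rewrite !ffunE; congr inr; apply/eqP; rewrite eqEcard XY.
by rewrite -cardY -(piY j) -eq_pi leq_imset_card.
Qed.

(** Double counting: each colour misses at least one of the [q.+2] parts. *)
Lemma sum_card_col X : disjoint_family D X -> \sum_j #|col X j| <= q.+1 * C.
Proof.
move=> dX.
have -> : \sum_j #|col X j| = \sum_j \sum_(c | X j \in G c) 1.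
  by apply: eq_bigr => j _; rewrite sum1dep_card.
rewrite (exchange_big_dep predT) //= mulnC -[in leqRHS](card_ord C) -sum_nat_const.
apply: leq_sum => c _; rewrite sum1_card.
have /forallPn[j0 Xj0] := G_disjoint c dX.
rewrite -ltnS -[in leqRHS](card_ord q.+2).
apply: proper_card; apply/properP; split; first by apply/subsetP.
by exists j0; rewrite ?inE.
Qed.

Let N := #|D| - q.+1 * C.

Lemma spread_of_level X : disjoint_family D X -> N <= nu X ->
  (forall j c, X j \notin G c) -> exists Y, spread pi G D N Y.
Proof.
move=> /disjoint_familyP[XD dX] /level_equitable[b [ba eb sb]] XG.
have /fin_all_exists[Y YP] j : exists B : {set T},
    [/\ B \subset X j, #|pi @: B| = b j & #|B| = b j].
  exact: transversal_of_size.
have YX j : Y j \subset X j by have [] := YP j.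
have cY j : #|Y j| = b j by have [] := YP j.
exists (finfun Y); apply/spreadP; split.
- apply/disjoint_familyP; split=> [j|i j ij]; rewrite !ffunE.
    exact: subset_trans (YX j) (XD j).
  exact: disjointWl (YX i) (disjointWr (YX j) (dX _ _ ij)).
- by move=> j; rewrite ffunE; apply/imset_injP/eqP; have [_ -> ->] := YP j.
- by move=> j c; rewrite ffunE; apply: contra (XG j c); apply: G_up.
- by move=> i j; rewrite !ffunE !cY.
- by rewrite -sb; apply: eq_bigr => j _; rewrite ffunE cY.
Qed.

Lemma prime_spread : exists X, spread pi G D N X.
Proof.
(* For [N = 0] the empty family works: if [G c] had the empty set, it would contain all parts of
   that family. *)
have [N0|N_gt0] := posnP N.
  have d0 : disjoint_family D [ffun _ : Zp => set0].
    apply/disjoint_familyP; split=> [j|i j _]; rewrite !ffunE ?sub0set //.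
    by rewrite -setI_eq0 set0I.
  exists [ffun=> set0]; apply/spreadP; split=> //.
  - by move=> j x y; rewrite ffunE inE.
  - move=> j c; apply: contra (G_disjoint c d0) => G0.
    by apply/forallP => i; move: G0; rewrite !ffunE.
  - by move=> i j; rewrite !ffunE cards0.
  - by rewrite N0 big1 // => j _; rewrite ffunE cards0.
apply/existsP; apply: contraT => /existsPn no_spread.
have hit X : disjoint_family D X -> N <= nu X -> exists j, exists c, X j \in G c.
  move=> dX leN.
  have : ~~ [forall j, forall c, X j \notin G c].
    apply/negP => /forallP XG; have [|Y sY] := spread_of_level dX leN.
      by move=> j; apply/forallP.
    by have := no_spread Y; rewrite sY.
  case/forallPn => j /forallPn[c]; rewrite negbK => Xjc.
  by exists j, c.
(* At level [N] some part is hit by a colour, so the second regime starts at rank [N], above the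
   first; by [sum_card_col] it ends below [#|D|]. *)
pose rho X := if nu X < N then nu X else N.-1 + \sum_j #|col X j|.
pose key X : {ffun Zp -> bool + {set K} + {set T} + {set 'I_C}} :=
  if nu X < N then [ffun j => inl (low_key X j)] else [ffun j => inr (col X j)].
have D0 : D != set0 by rewrite -card_gt0; move: N_gt0; rewrite /N; lia.
have colD X Y : (forall j, X j \subset Y j) -> forall j, col X j \subset col Y j.
  by move=> XY j; apply/subsetP => c; rewrite !inE; apply: G_up.
have nu_mono X Y : (forall j, X j \subset Y j) -> nu X <= nu Y.
  move=> XY; apply: level_mono => j; apply: subset_leq_card.
  exact: imsetS.
have sum_col X : disjoint_family D X -> N <= nu X -> 0 < \sum_j #|col X j|.
  move=> dX /(hit _ dX)[j [c Xjc]]; rewrite (bigD1 j) //= addn_gt0.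
  by apply/orP; left; apply/card_gt0P; exists c; rewrite inE.
have key_rot t X : key (rot_fun t X) = rot_fun t (key X).
  rewrite /key nu_rot; case: ifP => _; apply/ffunP => j; rewrite !ffunE.
    by rewrite low_key_rot ffunE.
  by congr inr; apply/setP => c; rewrite !inE ffunE.
have [||X dX] := tucker_family q_prime D0 key_rot (rho := rho).
- move=> X dX X0; have [_ Xd] := disjoint_familyP _ _ dX.
  rewrite /rho /key; case: (ltnP (nu X) N) => nuX; split.
  + have /existsP[j /set0Pn[x xX]] := X0.
    by apply: (@level_gt0 _ ord0 (nlab X) j); apply/card_gt0P; exists (pi x);
      apply: imset_f.
  + have /existsP[i /existsP[j ij]] := low_key_nonconstant dX X0.
    by apply/existsP; exists i; apply/existsP; exists j; rewrite !ffunE.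
  + by have := sum_col _ dX nuX; lia.
  (* Some colour hits a part but not all parts. *)
  + have [i [c Xic]] := hit _ dX nuX; have /forallPn[j Xjc] := G_disjoint c dX.
    apply/existsP; exists i; apply/existsP; exists j; rewrite !ffunE.
    apply/negP => /eqP[/setP/(_ c)]; rewrite !inE Xic => /esym Xjc'.
    by rewrite Xjc' in Xjc.
- move=> X Y dY X0 XY; have le_nu := nu_mono _ _ XY.
  have le_col j : #|col X j| <= #|col Y j| by rewrite subset_leq_card // colD.
  have le_sum : \sum_j #|col X j| <= \sum_j #|col Y j| by apply: leq_sum.
  rewrite /rho /key; case: (ltnP (nu Y) N) => nuY.
    rewrite (leq_ltn_trans le_nu nuY); split=> // eq_nu.
    by rewrite (eq_low_key dY XY eq_nu).
  have sumY := sum_col _ dY nuY.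
  case: (ltnP (nu X) N) => nuX; first by split; lia.
  split; first by lia.
  move/addnI => eq_sum; apply/ffunP => j; rewrite !ffunE; congr inr.
  by apply/eqP; rewrite eqEcard colD // (eq_leq_sum le_col eq_sum) leqnn.
rewrite /rho; case: (ltnP (nu X) N) => nuX; first by rewrite /N in nuX *; lia.
by have := sum_card_col dX; move: N_gt0; rewrite /N; lia.
Qed.

End PrimeCase.

Lemma spreadable_prime q : prime q.+2 -> spreadable 'I_q.+2.
Proof.
move=> pr T K pi C G D G_up D_small G_disjoint; rewrite card_ord in D_small *.
exact: prime_spread.
Qed.

(** * Multiplicativity in the number of parts *)

Lemma spreadable_card (J J' : finType) :
  #|J| = #|J'| -> spreadable J -> spreadable J'.
Proof.
move=> eqJ spJ T K pi C G D G_up D_small G_disjoint.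
pose h j : J' := enum_val (cast_ord eqJ (enum_rank j)).
pose g j : J := enum_val (cast_ord (esym eqJ) (enum_rank j)).
have gK : cancel g h by move=> j; rewrite /h /g enum_valK cast_ordKV enum_rankK.
have hK : cancel h g by move=> j; rewrite /h /g enum_valK cast_ordK enum_rankK.
have dg X : disjoint_family D X -> disjoint_family D [ffun j => X (g j)].
  move/disjoint_familyP => [XD dX]; apply/disjoint_familyP.
  split=> [j|i j ij]; rewrite !ffunE //; apply: dX.
  by rewrite (can_eq gK).
have [|c X dX|X] := spJ T K pi C G D G_up.
- by move=> k; rewrite eqJ.
- apply: contra (G_disjoint c _ (dg _ dX)) => /forallP XG.
  by apply/forallP => j; rewrite ffunE.
case/spreadP => dX tX bX eX sX; exists [ffun j => X (g j)]; apply/spreadP.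
split; first exact: dg.
- by move=> j; rewrite ffunE.
- by move=> j c; rewrite ffunE.
- by move=> i j; rewrite !ffunE.
- rewrite -eqJ -sX (reindex h) /=; last by exists g => j _.
  by apply: eq_bigr => j _; rewrite ffunE hK.
Qed.

(** Each class is cut into at most [r1] blocks of at most [r2] points; a set with at most one point
    per block meets the class in at most [r1] points. *)
Lemma refine_labels (T K : finType) (pi : T -> K) (D : {set T}) r1 r2 :
    0 < r2 -> (forall k, #|label_class pi D k| <= r1 * r2) ->
  exists (K' : finType) (pi' : T -> K'),
    (forall k, #|label_class pi' D k| <= r2) /\
    forall A : {set T}, A \subset D -> {in A &, injective pi'} ->
      forall k, #|label_class pi A k| <= r1.
Proof.
move=> r2_gt0 D_small.
pose cls x := label_class pi D (pi x).
pose rk x := index x (enum (cls x)).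
have rk_lt x : x \in D -> rk x < r1 * r2.
  move=> xD; apply: leq_trans (D_small (pi x)).
  by rewrite cardE index_mem mem_enum inE xD eqxx.
have rk_inj x y : x \in D -> y \in D -> pi x = pi y -> rk x = rk y -> x = y.
  move=> xD yD e; rewrite /rk /cls -e => exy; apply: (index_inj x _ _ exy).
    by rewrite mem_enum inE xD eqxx.
  by rewrite mem_enum inE yD e eqxx.
pose quo x : 'I_(r1 * r2).+1 := inord (rk x %/ r2).
have quoE x : x \in D -> quo x = rk x %/ r2 :> nat.
  move=> /rk_lt lt; rewrite inordK // ltnS.
  exact: leq_trans (leq_div _ _) (ltnW lt).
exists (K * 'I_(r1 * r2).+1)%type, (fun x => (pi x, quo x)); split.
  case=> k c; pose f x : 'I_r2 := Ordinal (ltn_pmod (rk x) r2_gt0).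
  rewrite -[leqRHS]card_ord; apply: (@leq_card_in _ _ f) => x y; rewrite !inE.
  case/andP=> xD /eqP[xk xc] /andP[yD /eqP[yk yc]] [eq_mod].
  apply: rk_inj => //; first by rewrite xk yk.
  by rewrite (divn_eq (rk x) r2) (divn_eq (rk y) r2) eq_mod -!quoE // xc yc.
move=> A AD injA k.
have ltr1 x : x \in D -> rk x %/ r2 < r1 by move/rk_lt; rewrite ltn_divLR.
case: r1 {D_small} rk_lt quo quoE injA ltr1 => [|r1] rk_lt quo quoE injA ltr1.
  rewrite leqNgt; apply/negP => /card_gt0P[x]; rewrite inE => /andP[/(subsetP AD) xD _].
  by have := ltr1 x xD.
pose f x : 'I_r1.+1 := inord (rk x %/ r2).
rewrite -[leqRHS]card_ord; apply: (@leq_card_in _ _ f) => x y; rewrite !inE.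
case/andP=> xA /eqP xk /andP[yA /eqP yk] /(congr1 val).
have xD := subsetP AD _ xA; have yD := subsetP AD _ yA.
rewrite /= !inordK ?ltr1 // => e.
by apply: injA => //; congr pair; [rewrite xk yk | apply: ord_inj; rewrite !quoE].
Qed.

(** Each entry is the average rounded up or down, which allows comparing entries of families with
    different totals. *)
Lemma equitable_bounds (J : finType) (b : J -> nat) :
  (forall i j, b i <= b j + 1) -> forall i,
  #|J| * b i < \sum_j b j + #|J| /\ \sum_j b j < #|J| * (b i).+1.
Proof.
move=> eb i; rewrite (bigD1 i) //=; set S := \sum_(j | _) _.
have cJ : #|[pred j | j != i]| = #|J|.-1 by apply: cardC1.
have J_gt0 : 0 < #|J| by apply/card_gt0P; exists i.
have lo : #|J|.-1 * b i <= S + #|J|.-1.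
  rewrite -cJ -sum_nat_const -[X in _ <= _ + X]sum1_card -big_split.
  exact: leq_sum.
have up : S <= #|J|.-1 * (b i).+1.
  by rewrite -cJ -sum_nat_const; apply: leq_sum => j _; rewrite -addn1.
by move: lo up; rewrite -(prednK J_gt0) /=; split; lia.
Qed.

(** The entries are all at least [d] or all at most [d], so truncated subtraction commutes with the
    sum. *)
Lemma equitable_sum_sub (J : finType) (b : J -> nat) d :
  (forall i j, b i <= b j + 1) -> \sum_j (b j - d) = \sum_j b j - #|J| * d.
Proof.
move=> eb; have [/forallP ge_d|/forallPn[i lt_d]] := boolP [forall j, d <= b j].
  rewrite [in RHS](eq_bigr (fun j => b j - d + d)) => [|j _]; last by rewrite subnK.
  by rewrite big_split /= sum_nat_const addnK.
have le_d j : b j <= d by have := eb j i; lia.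
rewrite big1 => [|j _]; last by have := le_d j; lia.
by apply/esym/eqP; rewrite subn_eq0 -sum_nat_const leq_sum.
Qed.

Lemma spreadable_prod (J1 J2 : finType) : 0 < #|J1| -> 0 < #|J2| ->
  spreadable J1 -> spreadable J2 -> spreadable (J1 * J2)%type.
Proof.
move=> J1_gt0 J2_gt0 sp1 sp2 T K pi C G D G_up D_small G_disjoint.
rewrite card_prod in D_small *.
have [K' [pi' [D_small' sub_small]]] := refine_labels J2_gt0 D_small.
(* [#|J2|] disjoint members of [G' c] would contain [#|J1| * #|J2|] disjoint members of [G c]. *)
pose G' c := [set A : {set T} | [exists Y : {ffun J1 -> {set T}},
  disjoint_family A Y && [forall i, Y i \in G c]]].
have [|//|c X dX|A] := sp2 T K' pi' C G' D.
- move=> c A B AB; rewrite !inE => /existsP[Y /andP[/disjoint_familyP[YA dY] YG]].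
  apply/existsP; exists Y; rewrite YG andbT; apply/disjoint_familyP; split=> // i.
  exact: subset_trans AB.
- have [XD dX'] := disjoint_familyP _ _ dX.
  apply/negP => /forallP XG.
  have /fin_all_exists[Y YP] j : exists Y : {ffun J1 -> {set T}},
      disjoint_family (X j) Y && [forall i, Y i \in G c].
    by apply/existsP; have := XG j; rewrite inE.
  pose Z := [ffun ij : J1 * J2 => Y ij.2 ij.1].
  suff /(G_disjoint c)/negP : disjoint_family D Z.
    apply; apply/forallP => -[i j]; rewrite ffunE.
    by have /andP[_ /forallP] := YP j; apply.
  have YX i j : Y j i \subset X j by have /andP[/disjoint_familyP[+ _] _] := YP j; apply.
  apply/disjoint_familyP; split=> [[i j]|[i j] [i' j']]; rewrite !ffunE /=.
    exact: subset_trans (YX i j) (XD j).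
  have [<-|jj' _] := eqVneq j j'.
    rewrite xpair_eqE eqxx andbT.
    by have /andP[/disjoint_familyP[_ +] _] := YP j; apply.
  exact: disjointWl (YX i j) (disjointWr (YX i' j') (dX' _ _ jj')).
(* Each [A j] lies outside [G' c] and has at most [#|J1|] points per original label, so it can be
   spread again over [J1]. *)
case/spreadP => dA tA bA eA sA; have [AD dA'] := disjoint_familyP _ _ dA.
have /fin_all_exists[X XP] j : exists X : {ffun J1 -> {set T}},
    spread pi G (A j) (#|A j| - #|J1|.-1 * C) X.
  apply: sp1 => //; first exact: sub_small.
  move=> c X dX; apply/negP => XG; have := bA j c; rewrite inE => /existsPn/(_ X).
  by rewrite dX XG.
have dX j : disjoint_family (A j) (X j) by have /spreadP[] := XP j.
have XA i j : X j i \subset A j by have /disjoint_familyP[] := dX j.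
exists [ffun ij => X ij.2 ij.1]; apply/spreadP; split.
- apply/disjoint_familyP; split=> [[i j]|[i j] [i' j']]; rewrite !ffunE /=.
    exact: subset_trans (XA i j) (AD j).
  have [<-|jj' _] := eqVneq j j'.
    rewrite xpair_eqE eqxx andbT.
    by have /disjoint_familyP[_] := dX j; apply.
  exact: disjointWl (XA i j) (disjointWr (XA i' j') (dA' _ _ jj')).
- by move=> [i j]; rewrite ffunE; have /spreadP[_ + _ _ _] := XP j; apply.
- by move=> [i j] c; rewrite ffunE; have /spreadP[_ _ + _ _] := XP j; apply.
- move=> [i j] [i' j']; rewrite !ffunE /=.
  have /spreadP[_ _ _ eX sX] := XP j; have /spreadP[_ _ _ eX' sX'] := XP j'.
  have [lo _] := equitable_bounds eX i; have [_ up] := equitable_bounds eX' i'.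
  rewrite sX in lo; rewrite sX' in up.
  have : #|J1| * #|X j i| < #|J1| * (#|X j' i'| + 2).
    rewrite addn2 mulnS; apply: leq_trans lo _; rewrite addnC leq_add2l.
    by apply: leq_trans up; have := eA j j'; lia.
  by rewrite ltn_mul2l => /andP[_]; rewrite addn2 addn1.
- have -> : \sum_ij #|[ffun ij => X ij.2 ij.1] ij| = \sum_i \sum_j #|X j i|.
    by rewrite pair_bigA; apply: eq_bigr => ij _; rewrite ffunE.
  rewrite exchange_big /= (eq_bigr (fun j => #|A j| - #|J1|.-1 * C)) => [|j _]; last first.
    by have /spreadP[] := XP j.
  rewrite equitable_sum_sub // sA -subnDA; congr (_ - _).
  (* The losses add up: [#|J2|.-1 + #|J2| * #|J1|.-1] is [(#|J1| * #|J2|).-1]. *)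
  rewrite mulnA -mulnDl; congr (_ * C).
  by case: #|J1| #|J2| J1_gt0 J2_gt0 => [|a] [|b] // _ _; rewrite mulSn mulnC /=; lia.
Qed.

Lemma spreadable_ord r : 1 < r -> spreadable 'I_r.
Proof.
elim/ltn_ind: r => r IHr r_gt1.
have [r_prime|r_nprime] := boolP (prime r).
  by case: r r_gt1 r_prime {IHr} => [|[|q]] // _; apply: spreadable_prime.
have p_gt1 : 1 < pdiv r by apply/prime_gt1/pdiv_prime.
have p_lt : pdiv r < r.
  rewrite ltn_neqAle pdiv_leq ?(ltnW r_gt1) // andbT.
  by apply: contraNneq r_nprime => <-; apply: pdiv_prime.
have er : r = pdiv r * (r %/ pdiv r) by rewrite mulnC divnK ?pdiv_dvd.
have d_gt1 : 1 < r %/ pdiv r by nia.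
have d_lt : r %/ pdiv r < r by apply: ltn_Pdiv => //; apply: ltnW.
apply: (@spreadable_card ('I_(pdiv r) * 'I_(r %/ pdiv r))%type).
  by rewrite card_prod !card_ord -er.
by apply: spreadable_prod; rewrite ?card_ord; try exact: ltnW; apply: IHr.
Qed.

(** * From spread families to Kneser hypergraphs *)

Lemma near_subsetW (T : finType) s (A B B' : {set T}) :
  B \subset B' -> near_subset s A B -> near_subset s A B'.
Proof.
move=> BB' /existsP[X /andP[sX AB]]; apply/existsP; exists X.
by rewrite sX (subset_trans AB).
Qed.

(** A common point outside both exceptional sets would lie in [A'] and [B']. *)
Lemma near_subset_card (T : finType) s (A B A' B' : {set T}) :
  [disjoint A' & B'] -> near_subset s A A' -> near_subset s B B' ->
  #|A :&: B| <= s.*2.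
Proof.
move=> dAB /existsP[X /andP[sX AX]] /existsP[Y /andP[sY BY]].
have : A :&: B \subset X :|: Y.
  apply/subsetP => x /setIP[xA xB]; rewrite inE.
  apply: contraLR dAB; rewrite negb_or => /andP[xX xY].
  apply/pred0Pn; exists x => /=.
  by rewrite (subsetP AX) ?(subsetP BY) // inE ?xX ?xY.
move/subset_leq_card/leq_trans; apply; rewrite cardsU -addnn.
exact: leq_trans (leq_subr _ _) (leq_add sX sY).
Qed.

Theorem theorem5 (n r s : nat) (P F : {set {set 'I_n}})
    (n_ge1 : 1 <= n) (r_ge2 : 2 <= r)
    (P_part : partition P [set: 'I_n])
    (P_small : forall B : {set 'I_n}, B \in P -> #|B| <= r)
    (F_nonempty : forall A : {set 'I_n}, A \in F -> A != set0)
    (F_large : forall A : {set 'I_n}, A \in F -> s < #|A|)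
    (FP_good : good F P s./2) :
  (Num.ceil ((ecd r F s./2)%:R / (r - 1)%:R : rat)
    <= (chromatic_number (KG r F P s))%:Z)%R.
Proof.
pose V := KG_vertex F P; pose C := chromatic_number (KG r F P s).
have edge_gt1 e : e \in KG r F P s -> (1 < #|e|)%N.
  by rewrite inE => /andP[/eqP->].
have [/existsP[c /forall_inP c_ok] _] := chromatic_numberP edge_gt1.
rewrite -/C in c c_ok *.
pose G (k : 'I_C) := [set A : {set 'I_n} |
  [exists v : V, (c v == k) && near_subset s./2 (val v) A]].
have G_up k (A B : {set 'I_n}) : A \subset B -> A \in G k -> B \in G k.
  move=> AB; rewrite !inE => /existsP[v /andP[cv vA]].
  by apply/existsP; exists v; rewrite cv (near_subsetW AB).
have F_half A : A \in F -> (s./2 < #|A|)%N.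
  by move=> AF; have := F_large A AF; lia.
have [/and3P[/eqP Pcov Ptriv _]] := P_part.
have small (k : {set 'I_n}) : (#|label_class (pblock P) [set: 'I_n] k| <= #|'I_r|)%N.
  rewrite card_ord; have [kP|kP] := boolP (k \in P).
    apply: leq_trans (P_small k kP); apply: subset_leq_card; apply/subsetP => x.
    by rewrite !inE => /eqP <-; rewrite mem_pblock Pcov.
  (* As [P] covers all points, a label outside [P] has no points. *)
  rewrite (_ : label_class _ _ _ = set0) ?cards0 //; apply/setP => x; rewrite !inE.
  by apply: contraNF kP => /eqP <-; rewrite pblock_mem ?Pcov.
have G_disjoint k (X : {ffun 'I_r -> {set 'I_n}}) :
    disjoint_family [set: 'I_n] X -> ~~ [forall j, X j \in G k].
  move=> /disjoint_familyP[_ dX]; apply/negP => /forallP XG.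
  have /fin_all_exists[v vP] j : exists v : V, (c v == k) && near_subset s./2 (val v) (X j).
    by apply/existsP; have := XG j; rewrite inE.
  have v_small i j : i != j -> (#|val (v i) :&: val (v j)| <= s)%N.
    move=> ij; have /andP[_ ni] := vP i; have /andP[_ nj] := vP j.
    apply: leq_trans (near_subset_card (dX _ _ ij) ni nj) _.
    by rewrite -[leqRHS]odd_double_half leq_addl.
  (* A vertex chosen for two parts would meet itself in at most [s] points, but it has more. *)
  have v_inj : injective v.
    move=> i j vij; apply/eqP; apply: contraT => /v_small.
    by rewrite vij setIid leqNgt F_large //; have /andP[] := valP (v j).
  have e_edge : [set v j | j : 'I_r] \in KG r F P s.
    rewrite inE card_imset // card_ord eqxx /=.
    apply/forall_inP => A /imsetP[i _ ->]; apply/forall_inP => B /imsetP[j _ ->].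
    by apply/implyP => vij; apply: v_small; apply: contraNneq vij => ->.
  case/negP: (c_ok _ e_edge).
  apply/forall_inP => A /imsetP[i _ ->]; apply/forall_inP => B /imsetP[j _ ->].
  by have /andP[/eqP-> _] := vP i; have /andP[/eqP-> _] := vP j.
have [X] := spreadable_ord r_ge2 G_up small G_disjoint.
rewrite cardsT !card_ord => /spreadP[/disjoint_familyP[_ dX] tX bX eX sX].
pose X0 := ~: \bigcup_j X j.
have X0_small : (#|X0| <= (r - 1) * C)%N.
  have := cardsC (\bigcup_j X j); rewrite card_ord card_bigcup_disjoint // sX -/X0.
  by rewrite subn1; lia.
have X_adm j : admissible P (X j).
  apply/forall_inP => B BP; apply/card_le1_eqP => x y /setIP[xX xB] /setIP[yX yB].
  by apply: (tX j) => //; rewrite (def_pblock Ptriv BP xB) (def_pblock Ptriv BP yB).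
have X0_ok : ecd_admits r F s./2 X0.
  apply/existsP; exists X; apply/andP; split.
    apply/and3P; split; first by rewrite setCK.
      by apply/forallP => i; apply/forallP => j; apply/implyP; apply: dX.
    by apply/forallP => i; apply/forallP.
  apply/forall_inP => A AF; apply/forallP => j; apply/negP => nA.
  (* Goodness replaces [A] by a vertex [B], whose colour puts [X j] into some [G k]. *)
  have [|B [BF Badm nB]] := FP_good _ (X_adm j); first by exists A.
  have vB : (B \in F) && admissible P B by rewrite BF.
  have /negP := bX j (c (Sub B vB : V)); apply; rewrite inE.
  by apply/existsP; exists (Sub B vB); rewrite eqxx SubK.
have [_ /(_ _ X0_ok) ecd_le] := ecdP r F_half.
have r1_gt0 : (0 < (r - 1)%:R :> rat)%R by rewrite ltr0n subn_gt0.
rewrite ceil_le_int ler_pdivrMr // -natrM ler_nat mulnC.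
exact: leq_trans ecd_le X0_small.
Qed.
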